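(* The set $\mathcal{A}=\{f:\ \int_0^1 f(x)\,dx=0\}$ is Haar-$1$ in $L^1[0,1]$; likewise, the set of $f\in C[0,1]$ with $\int_0^1 f(x)\,dx=0$ is Haar-$1$ in $C[0,1]$.
   Context: $L^1[0,1]$ (real-valued integrable functions with the $L^1$ norm) and $C[0,1]$ (real-valued continuous functions with the supremum norm) are regarded as abelian Polish groups under addition. A subset $A$ of an abelian Polish group $X$ is Haar-$1$ if there are a Borel set $B\subseteq X$ with $A\subseteq B$ and a homeomorphic copy $C\subseteq X$ of $2^\omega$ such that $|(C+x)\cap B|\leq 1$ for all $x\in X$. *)

(* Defs.v *)
From HB Require Import structures.
From mathcomp Require Import all_boot all_order all_algebra.
From mathcomp Require Import all_classical all_reals all_analysis.
From mathcomp Require Import measurable_realfun.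

Set Implicit Arguments.
Unset Strict Implicit.
Unset Printing Implicit Defensive.
Import Order.TTheory GRing.Theory Num.Theory.
Import numFieldNormedType.Exports.

Local Open Scope classical_set_scope.
Local Open Scope ring_scope.

Definition homeomorphic (S T : topologicalType) : Prop :=
  exists (f : S -> T) (g : T -> S),
    [/\ cancel f g, cancel g f, continuous f & continuous g].

Definition borel_set (X : topologicalType) (B : set X) : Prop :=
  <<s @open X >> B.

(* The notion is usually reserved to abelian Polish groups; the definition
   itself only uses the group law and the topology. A subset [C : set X]
   coerces to the subtype of its elements, with the induced topology. *)
Definition Haar1 (X : topologicalZmodType) (A : set X) : Prop :=
  exists B : set X, exists C : set X,
    [/\ borel_set B, A `<=` B, homeomorphic cantor_space C &
        forall x : X, ([set c + x | c in C] `&` B #<= `I_1)%card].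

Section L1.
Context d (T : measurableType d) (R : realType).
Variable mu : {measure set T -> \bar R}.

Local Notation lfun := (LfunType mu (lexx 1%E)).

Definition ae_null : {pred lfun} := fun f => `[< f = cst 0 %[ae mu] >].

Let ae_null_submod_closed : submod_closed ae_null.
Proof.
split=> [|a f g /asboolP f0 /asboolP g0]; first exact/asboolP/aeW.
apply/asboolP; near=> x => _ /=.
rewrite [LHS](_ : _ = a * f x + g x)//.
have -> : f x = 0 by near: x; apply: filterS f0 => x; exact.
have -> : g x = 0 by near: x; apply: filterS g0 => x; exact.
by rewrite mulr0 addr0.
Unshelve. all: by end_near. Qed.

HB.instance Definition _ := GRing.isSubmodClosed.Build R lfun ae_null
  ae_null_submod_closed.

Definition L1 : Type := Quotient.quot ae_null.

HB.instance Definition _ := GRing.Zmodule.on L1.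
HB.instance Definition _ := EqQuotient.on L1.

(* An integrable representative: every notion below is a.e. invariant. *)
Definition L1_fun (f : L1) : T -> R := repr f.
Definition L1_pi (f : lfun) : L1 := \pi_L1%qT f.

Definition L1_norm (f : L1) : R := fine 'N[mu]_1[EFin \o L1_fun f].
Definition L1_scale (a : R) (f : L1) : L1 := L1_pi (a *: repr f).

Lemma L1_funK (f : lfun) : L1_fun (L1_pi f) = f %[ae mu].
Proof.
have : (repr (L1_pi f) - f \in ae_null).
  by rewrite Quotient.idealrBE reprK.
move=> /asboolP H; near=> x => _.
apply/eqP; rewrite -subr_eq0; apply/eqP.
by near: x; apply: filterS H => x; exact.
Unshelve. all: by end_near. Qed.

Lemma L1_fun_inj (f g : L1) : L1_fun f = L1_fun g %[ae mu] -> f = g.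
Proof.
move=> fg; rewrite -[f]reprK -[g]reprK; apply/eqP; rewrite -Quotient.idealrBE.
apply/asboolP; near=> x => _.
rewrite [LHS](_ : _ = repr f x - repr g x)//; apply/eqP; rewrite subr_eq0.
by apply/eqP; near: x; apply: filterS fg => x; exact.
Unshelve. all: by end_near. Qed.

Lemma L1_funD (f g : L1) : L1_fun (f + g) = L1_fun f \+ L1_fun g %[ae mu].
Proof.
have -> : f + g = L1_pi (repr f + repr g).
  by rewrite /L1_pi Quotient.pi_add !reprK.
exact: L1_funK.
Qed.

Lemma L1_funZ a (f : L1) : L1_fun (L1_scale a f) = a \*: L1_fun f %[ae mu].
Proof. exact: L1_funK. Qed.

Lemma L1_normE (f : L1) : (L1_norm f)%:E = 'N[mu]_1[EFin \o L1_fun f]%E.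
Proof. exact: finite_norm_fine. Qed.

Lemma L1_norm_ae (f : L1) (g : lfun) :
  L1_fun f = g %[ae mu] -> (L1_norm f)%:E = 'N[mu]_1[EFin \o g]%E.
Proof.
have mabs (h : lfun) : measurable_fun [set: T] (abse \o (EFin \o h)).
  by apply: measurableT_comp; [exact: abse_measurable|apply/measurable_EFinP].
move=> fg; rewrite L1_normE !Lnorm1; apply: ae_eq_integral => //.
- exact: mabs.
- exact: mabs.
- by apply: filterS fg => x /[apply] /= ->.
Qed.

Let scaleA a b (f : L1) : L1_scale a (L1_scale b f) = L1_scale (a * b) f.
Proof.
apply: L1_fun_inj.
apply: (filterS3 _ _ (L1_funZ a (L1_scale b f)) (L1_funZ (a * b) f) (L1_funZ b f)).
by move=> x abf /(_ I) -> bf _; rewrite abf//= bf//= scalerA.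
Qed.

Let scale1 : left_id 1 L1_scale.
Proof. by move=> f; rewrite /L1_scale scale1r /L1_pi reprK. Qed.

Let scaleDr : right_distributive L1_scale +%R.
Proof.
move=> a f g; apply: L1_fun_inj.
apply: (filterS3 _ _ (L1_funD (L1_scale a f) (L1_scale a g))
  (filterI (L1_funZ a f) (L1_funZ a g))
  (filterI (L1_funZ a (f + g)) (L1_funD f g))).
move=> x afg [af ag] [afg' fg] _.
by rewrite afg// afg'//= fg//= af// ag//= scalerDr.
Qed.

Let scaleDl f : {morph L1_scale^~ f : a b / a + b}.
Proof.
move=> a b; apply: L1_fun_inj.
apply: (filterS3 _ _ (L1_funZ (a + b) f) (L1_funD (L1_scale a f) (L1_scale b f))
  (filterI (L1_funZ a f) (L1_funZ b f))).
by move=> x abf afbf [af bf] _; rewrite abf// afbf//= af// bf//= scalerDl.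
Qed.

HB.instance Definition _ := GRing.Zmodule_isLmodule.Build R L1
  scaleA scale1 scaleDr scaleDl.

Let L1_ler_normD f g : L1_norm (f + g) <= L1_norm f + L1_norm g.
Proof.
rewrite -lee_fin EFinD (L1_norm_ae (g := repr f + repr g)); last exact: L1_funD.
by rewrite !L1_normE; apply: eminkowski.
Qed.

Let L1_normrZ (a : R) (f : L1) : L1_norm (a *: f) = `|a| * L1_norm f.
Proof.
apply: EFin_inj; rewrite (L1_norm_ae (g := a *: repr f)); last exact: L1_funZ.
by rewrite EFinM L1_normE; exact: LnormZ.
Qed.

Let L1_normr0_eq0 f : L1_norm f = 0 -> f = 0.
Proof.
move=> /fine_Lnormr_eq0 f0; apply: L1_fun_inj.
have -> : (0 : L1) = L1_pi 0 by rewrite /L1_pi pi_zeror.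
by apply: (filterS2 _ _ f0 (L1_funK 0)) => x fx0 -> // _; rewrite fx0.
Qed.

HB.instance Definition _ := @Lmodule_isNormed.Build R L1 L1_norm
  L1_ler_normD L1_normrZ L1_normr0_eq0.
End L1.

Section C01.
Variable R : realType.

Local Notation I01 := (`[0, 1]%classic : set R).

Definition continuous_on01 : {pred I01 -> R} := fun f => `[< continuous f >].

Let continuous_on01_submod_closed : submod_closed continuous_on01.
Proof.
split=> [|a f g /asboolP cf /asboolP cg]; first exact/asboolP/cst_continuous.
apply/asboolP => x; apply: (@cvgD _ _ _ _ _ (a *: f) g _ _ _ (cg x)).
exact: (cvgM (cvg_cst a) (cf x)).
Qed.

HB.instance Definition _ := GRing.isSubmodClosed.Build R (I01 -> R)
  continuous_on01 continuous_on01_submod_closed.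

Record C01 : Type := MkC01 {
  C01_fun :> I01 -> R ;
  _ : C01_fun \in continuous_on01 }.

HB.instance Definition _ := [isSub for C01_fun].
HB.instance Definition _ := [Choice of C01 by <:].
HB.instance Definition _ := [SubChoice_isSubLmodule of C01 by <:].

Lemma C01_continuous (f : C01) : continuous f.
Proof. exact/asboolP/(valP f). Qed.

Definition C01_norm (f : C01) : R := sup (range (fun x => `|f x|)).

Let I01_0 : (0 : R) \in I01.
Proof. by rewrite inE/= in_itv/= lexx ler01. Qed.

Lemma C01_has_sup (f : C01) : has_sup (range (fun x => `|f x|)).
Proof.
split; first by exists `|f (SigSub I01_0)|, (SigSub I01_0).
have cf : {within I01, continuous ('valL_ 0 f)}.
  exact/subspace_valL_continuousP'/C01_continuous.
have [M [_ fM]] :=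
  compact_bounded (continuous_compact cf (@segment_compact _ 0 1)).
exists (M + 1) => _ [x _ <-]; apply: (fM (M + 1)); first by rewrite ltrDl.
exists (val x); first exact/set_mem/(valP x).
exact: (congr1 (fun g => g x) (valLK 0 f)).
Qed.

Lemma C01_le_norm (f : C01) x : `|f x| <= C01_norm f.
Proof. by apply: sup_ubound; [case: (C01_has_sup f)|exists x]. Qed.

Lemma C01_norm_le (f : C01) M : (forall x, `|f x| <= M) -> C01_norm f <= M.
Proof.
move=> fM; apply: ge_sup; first by case: (C01_has_sup f).
by move=> _ [x _ <-].
Qed.

Let C01_ler_normD f g : C01_norm (f + g) <= C01_norm f + C01_norm g.
Proof.
apply: C01_norm_le => x; apply: (le_trans (ler_normD _ _)).
by apply: lerD; exact: C01_le_norm.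
Qed.

Let C01_normrZ (a : R) (f : C01) : C01_norm (a *: f) = `|a| * C01_norm f.
Proof.
have leZ b g : C01_norm (b *: g) <= `|b| * C01_norm g.
  apply: C01_norm_le => x; rewrite [X in X <= _]normrM.
  by rewrite ler_wpM2l// C01_le_norm.
apply/eqP; rewrite eq_le leZ/=; have [->|a0] := eqVneq a 0.
  rewrite normr0 mul0r; apply: le_trans (C01_le_norm _ (SigSub I01_0)).
  exact: normr_ge0.
rewrite mulrC -ler_pdivlMr ?normr_gt0// mulrC -normfV.
by rewrite -[f in X in X <= _](scalerK a0) leZ.
Qed.

Let C01_normr0_eq0 f : C01_norm f = 0 -> f = 0.
Proof.
move=> f0; apply/val_inj/funext => x; apply/eqP; rewrite -normr_le0.
by have := C01_le_norm f x; rewrite f0.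
Qed.

HB.instance Definition _ := @Lmodule_isNormed.Build R C01 C01_norm
  C01_ler_normD C01_normrZ C01_normr0_eq0.

End C01.

(* Lebesgue measure on R, killed outside [0, 1]: functions on R that agree a.e.
   on [0, 1] are identified, so [L1 lebesgue01] is $L^1[0,1]$. *)
Definition lebesgue01 (R : realType) :
    {measure set (measurableTypeR R) -> \bar R} :=
  mrestr lebesgue_measure (measurable_itv `[(0 : R), 1]).

(* Main.v *)
(** In either space the integral is a linear functional of norm at most 1 which
    does not vanish at the constant function 1. Its kernel is closed, hence
    Borel, and a translate of the line of constant functions meets the kernel
    in one point; so a Cantor set of constant functions is a witness. *)

Require Import Defs.
From mathcomp Require Import all_boot all_order all_algebra.
From mathcomp Require Import all_classical all_reals all_analysis.
From mathcomp Require Import measurable_realfun.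
From mathcomp Require Import lra.

Import Order.TTheory GRing.Theory Num.Theory.
Import numFieldNormedType.Exports.

Local Open Scope classical_set_scope.
Local Open Scope ring_scope.

(** * Embedding of the Cantor space into the reals by ternary expansions *)

Section cantor_embedding.
Context {R : realType}.
Implicit Types x y : cantor_space.

(* The digits are 0 and 1 rather than 0 and 2, so the n-th tail is at most
   (3 / 2) * 3^-n, which is strictly less than a digit 1 at position n - 1. *)
Definition ternary_sum x n : R := \sum_(i < n) (x i)%:R * 3^-1 ^+ i.

(** The partial sums are nondecreasing and bounded, so this supremum is the sum of the series. *)
Definition ternary x : R := sup (range (ternary_sum x)).

Let third_gt0 n : 0 < (3^-1 : R) ^+ n. Proof. by rewrite exprn_gt0. Qed.

Lemma ternary_sumS x n :
  ternary_sum x n.+1 = ternary_sum x n + (x n)%:R * 3^-1 ^+ n.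
Proof. exact: big_ord_recr. Qed.

Lemma ternary_sum_nondecreasing x n k :
  ternary_sum x n <= ternary_sum x (n + k).
Proof.
elim: k => [|k /le_trans]; first by rewrite addn0.
by apply; rewrite addnS ternary_sumS lerDl mulr_ge0 ?ler0n// ltW.
Qed.

(** The term [3 / 2 * 3^-1 ^+ n] is the whole tail from position [n] when every digit is 1. Adding
    one digit costs at most [3^-1 ^+ n], which is exactly what this bound loses from [n] to
    [n.+1]. *)
Lemma ternary_sum_upper x n k :
  ternary_sum x (n + k) + 3 / 2 * 3^-1 ^+ (n + k) <=
  ternary_sum x n + 3 / 2 * 3^-1 ^+ n.
Proof.
elim: k => [|k]; first by rewrite addn0.
move=> /(le_trans _); apply; rewrite addnS ternary_sumS exprS.
by have := third_gt0 (n + k); case: (x (n + k)) => /=; lra.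
Qed.

Lemma ternary_sum_le x m n :
  ternary_sum x m <= ternary_sum x n + 3 / 2 * 3^-1 ^+ n.
Proof.
have gt0 := third_gt0.
have [/subnKC <-|/ltnW/subnKC <-] := leqP m n.
  have := ternary_sum_nondecreasing x m (n - m).
  by have := gt0 (m + (n - m))%N; lra.
have := ternary_sum_upper x n (m - n).
by have := gt0 (n + (m - n))%N; lra.
Qed.

Lemma ternary_ge x n : ternary_sum x n <= ternary x.
Proof.
apply: sup_ubound; last by exists n.
by exists (ternary_sum x 0 + 3 / 2 * 3^-1 ^+ 0) => _ [m _ <-]; exact: ternary_sum_le.
Qed.

Lemma ternary_le x n : ternary x <= ternary_sum x n + 3 / 2 * 3^-1 ^+ n.
Proof.
apply: ge_sup; first by exists (ternary_sum x 0), 0%N.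
by move=> _ [m _ <-]; exact: ternary_sum_le.
Qed.

Lemma eq_ternary_sum x y n :
  (forall i, (i < n)%N -> x i = y i) -> ternary_sum x n = ternary_sum y n.
Proof. by move=> xy; apply: eq_bigr => i _; rewrite xy. Qed.

Lemma near_eq_prefix x n : \forall y \near x, forall i, (i < n)%N -> x i = y i.
Proof.
elim: n => [|n IHn]; first by apply: filterE.
have xn : \forall y \near x, (y : cantor_space) n = x n.
  exact: (@proj_continuous nat (fun=> bool) n x _ (discrete_set1 (x n))).
apply: filterS2 IHn xn => y xy xyn i.
by rewrite ltnS leq_eqVlt => /predU1P[->//|/xy].
Qed.

(** Sequences sharing their first [n] digits with [x] form a neighbourhood of [x], and their values
    lie in one interval of length [3 / 2 * 3^-1 ^+ n]. *)
Lemma ternary_continuous : continuous ternary.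
Proof.
move=> x; apply/cvgrPdist_lt => e e0.
have [n ne] : exists n, 3 / 2 * 3^-1 ^+ n < e.
  have : 3 / 2 * (3^-1 : R) ^+ n @[n --> \oo] --> 0.
    by apply: cvg_geometric; rewrite ger0_norm; lra.
  by move=> /cvgr_lt/(_ e e0)[n _ lte]; exists n; exact: lte n (leqnn n).
apply: filterS (near_eq_prefix x n) => y /eq_ternary_sum xy.
have := ternary_ge x n; have := ternary_le x n.
have := ternary_ge y n; have := ternary_le y n.
by rewrite xy ltr_norml; lra.
Qed.

Lemma ternary_inj : injective ternary.
Proof.
(* At the first difference [x] has digit 0 and [y] digit 1: the tail of [x] after it is at most half
   of [3^-1 ^+ n], the amount that [y] gains there. *)
have lt_ternary x y n : (forall i, (i < n)%N -> x i = y i) ->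
    (x n < y n)%N -> ternary x < ternary y.
  move=> /eq_ternary_sum xy; have gt0 := third_gt0 n.
  have := ternary_le x n.+1; have := ternary_ge y n.+1.
  rewrite !ternary_sumS xy exprS; case: (x n) (y n) => -[]//=.
  by rewrite -/(ternary x); lra.
move=> x y xy; apply/funext => n; apply/eqP.
elim/ltn_ind: n => n /(_ _ _)/eqP IHn.
have yx i : (i < n)%N -> y i = x i by move=> /IHn.
have [] := ltngtP (x n) (y n); last by case: (x n) (y n) => -[].
  by move=> /(lt_ternary _ _ _ IHn); rewrite xy ltxx.
by move=> /(lt_ternary _ _ _ yx); rewrite xy ltxx.
Qed.

End cantor_embedding.

(** * Kernels of bounded functionals are Haar-1 *)

Lemma compact_inj_homeomorphic (S T : topologicalType) (f : S -> T) :
  compact [set: S] -> hausdorff_space T -> continuous f -> injective f ->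
  homeomorphic S (range f).
Proof.
move=> cS hT cf injf.
pose f' x : range f := SigSub (mem_set (imageT f x)).
pose g (y : range f) : S := sval (cid2 (set_mem (valP y))).
have gE y : f (g y) = val y by rewrite /g; case: cid2.
exists f', g; split.
- by move=> x; apply: injf; rewrite gE.
- by move=> y; apply: val_inj; exact: gE.
- exact: continuous_comp_initial.
(* The inverse is continuous because [f] is a closed map: a closed subset of the compact [S] has a
   compact image, which is closed in the Hausdorff space [T]. *)
- apply/continuous_closedP => A clA.
  have -> : g @^-1` A = val @^-1` (f @` A).
    apply/seteqP; split=> y /=; first by exists (g y).
    by move=> [x Ax]; rewrite -gE => /injf <-.
  apply: preimage_closed => [y _|]; first exact: initial_continuous.
  apply: compact_closed => //; apply: continuous_compact.
    exact: continuous_subspaceT.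
  by apply: subclosed_compact clA cS _.
Qed.

Lemma card_le1 T (A : set T) : is_subset1 A -> (A #<= `I_1)%card.
Proof.
move=> A1; have [->|/set0P[x Ax]] := eqVneq A set0; first exact: card_ge0.
apply: (@card_le_trans _ _ _ [set x]).
  by apply: subset_card_le => y Ay; exact: A1.
by have := @card_set1 _ x; rewrite card_eq_le => /andP[].
Qed.

Lemma Haar1_ker (R : realType) (X : normedModType R) (phi : X -> R) (e : X) :
  scalar phi -> (forall x, `|phi x| <= `|x|) -> phi e != 0 ->
  Haar1 [set x | phi x = 0].
Proof.
move=> linphi phile phie.
have phiD x y : phi (x + y) = phi x + phi y.
  by rewrite -[x in LHS]scale1r linphi mul1r.
have phiB x y : phi (x - y) = phi x - phi y.
  by rewrite -scaleN1r addrC linphi mulN1r addrC.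
have phiZ a : phi (a *: e) = a * phi e.
  have := linphi a e 0; rewrite addr0 => ->.
  by have := phiB 0 0; rewrite !subrr => ->; rewrite addr0.
(* By additivity, the norm bound makes [phi] 1-Lipschitz. *)
have phic : continuous phi.
  move=> x; apply/cvgrPdist_lt => eps eps0.
  have /cvgrPdist_lt/(_ _ eps0) : id y @[y --> x] --> x by [].
  apply: filterS => y.
  by rewrite -phiB; exact: le_lt_trans.
have ker_closed : closed (phi @^-1` [set 0]).
  by apply: preimage_closed (@closed_eq R 0) => x _; exact: phic.
pose h (x : cantor_space) : X := ternary x *: e.
exists [set x | phi x = 0], (range h); split=> //.
- rewrite -[X in borel_set X]setCK -setTD.
  apply: sigma_algebraCD; apply: sub_gen_smallest.
  exact: closed_openC.
- apply: compact_inj_homeomorphic.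
  + exact: cantor_space_compact.
  + exact: norm_hausdorff.
  + by move=> x; apply: cvgZr_tmp; exact: ternary_continuous.
  + move=> x y /(congr1 phi); rewrite /h !phiZ => /(mulIf phie).
    exact: ternary_inj.
(* If two points of the translate lie in the kernel, applying [phi] and cancelling [phi x], then the
   nonzero [phi e], shows that their coefficients agree. *)
- move=> x; apply: card_le1 => _ _ [[_ [a _ <-] <-] pa] [[_ [b _ <-] <-] pb].
  move: pa pb; rewrite /h /= !phiD !phiZ => <- /eqP.
  by rewrite (inj_eq (addIr _)) => /eqP/(mulIf phie) ->.
Qed.

(** * The integral as a functional on the L1 space of a measure *)

Section L1_integral.
Context d (T : measurableType d) (R : realType).
Variable mu : {measure set T -> \bar R}.
Implicit Types f g : L1 mu.

Lemma L1_fun_integrable f : mu.-integrable [set: T] (EFin \o L1_fun f).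
Proof. exact/Lfun1_integrable/LfunP. Qed.

(** The chosen representatives respect the operations on classes only almost everywhere; this lemma
    carries such identities over to integrals. *)
Lemma ae_eq_Rintegral (f g : T -> R) :
  measurable_fun [set: T] f -> measurable_fun [set: T] g ->
  f = g %[ae mu] -> \int[mu]_x f x = \int[mu]_x g x.
Proof.
move=> mf mg fg; congr fine; apply: ae_eq_integral => //.
- exact/measurable_EFinP.
- exact/measurable_EFinP.
- by apply: filterS fg => x /[apply] /= ->.
Qed.

Lemma measurable_L1_fun f : measurable_fun [set: T] (L1_fun f).
Proof. exact/measurable_EFinP/measurable_int/L1_fun_integrable. Qed.

Lemma L1_integral_scalar : scalar (fun f : L1 mu => \int[mu]_x L1_fun f x).
Proof.
move=> a f g.
have -> : \int[mu]_x L1_fun (a *: f + g) x =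
          \int[mu]_x (a * L1_fun f x + L1_fun g x).
  apply: ae_eq_Rintegral; first exact: measurable_L1_fun.
    apply: measurable_funD; last exact: measurable_L1_fun.
    by apply: measurable_funM => //; exact: measurable_L1_fun.
  apply: filterS2 (L1_funD (a *: f) g) (L1_funZ a f) => x fg af _.
  by rewrite fg//= af.
have iaf : mu.-integrable [set: T] (EFin \o (fun x => a * L1_fun f x)).
  exact: (integrableZl measurableT a (L1_fun_integrable f)).
rewrite RintegralD//; last exact: L1_fun_integrable.
by rewrite RintegralZl//; exact: L1_fun_integrable.
Qed.

Lemma L1_integral_le_norm f : `|\int[mu]_x L1_fun f x| <= `|f|.
Proof.
have -> : `|f| = \int[mu]_x `|L1_fun f x|.
  by rewrite -[LHS]/(L1_norm f) /L1_norm Lnorm1.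
by apply: le_normr_Rintegral => //; exact: L1_fun_integrable.
Qed.

End L1_integral.

(** Finite total mass puts the constant 1 in L1, and nonzero mass makes its integral nonzero. *)
Lemma Haar1_L1_integral0 d (T : measurableType d) (R : realType)
    (mu : {measure set T -> \bar R}) :
  mu setT != 0%E -> (mu setT < +oo)%E ->
  Haar1 [set f : L1 mu | \int[mu]_x L1_fun f x = 0].
Proof.
move=> mu0 muoo.
have muf : mu setT \is a fin_num by rewrite ge0_fin_numE.
have cst1 : cst 1 \in Lfun mu 1.
  apply/Lfun1_integrable/integrableP; split; first exact/measurable_EFinP.
  rewrite (eq_integral (cst 1%E)) ?integral_cst ?mul1e//.
  by move=> x _ /=; rewrite normr1.
apply: (@Haar1_ker _ _ (fun f : L1 mu => \int[mu]_x L1_fun f x)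
  (L1_pi (Lfun_Sub (lexx 1%E) cst1))).
- exact: L1_integral_scalar.
- exact: L1_integral_le_norm.
- have -> : \int[mu]_x L1_fun (L1_pi (Lfun_Sub (lexx 1%E) cst1)) x =
            \int[mu]_x cst 1 x.
    by apply: ae_eq_Rintegral (L1_funK _); first exact: measurable_L1_fun.
  by rewrite Rintegral_cst// mul1r fine_eq0.
Qed.

(** * The integral as a functional on C[0,1] *)

Section C01_integral.
Context {R : realType}.
Implicit Types f g : C01 R.

Local Notation mu := (@lebesgue_measure R).
Local Notation I01 := (`[0, 1]%classic : set R).

(** Elements of [C01] live on a subtype, so they are integrated through their extension by 0 to the
    real line. *)
Lemma valL_val f (x : I01) : ('valL_ 0 f) (val x) = f x.
Proof. exact: (congr1 (fun h => h x) (valLK 0 f)). Qed.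

Lemma valL_C01_integrable f : mu.-integrable I01 (EFin \o ('valL_ 0 f)).
Proof.
apply: continuous_compact_integrable; first exact: segment_compact.
exact/subspace_valL_continuousP'/C01_continuous.
Qed.

Lemma C01_integral_scalar :
  scalar (fun f : C01 R => \int[mu]_(x in `[0, 1]) ('valL_ 0 f) x).
Proof.
move=> a f g.
have mI : measurable (I01 : set (measurableTypeR R)) by exact: measurable_itv.
have -> : \int[mu]_(x in `[0, 1]) ('valL_ 0 (a *: f + g)) x =
    \int[mu]_(x in `[0, 1]) (a * ('valL_ 0 f) x + ('valL_ 0 g) x).
  apply: eq_Rintegral => x xI.
  (* Seeing [x] as a point of the subtype lets the operations of [C01] compute pointwise. *)
  by rewrite -[x]/(val (SigSub xI : I01)) !valL_val.
have iaf : mu.-integrable I01 (EFin \o (fun x => a * ('valL_ 0 f) x)).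
  exact: (integrableZl mI a (valL_C01_integrable f)).
rewrite RintegralD//; last exact: valL_C01_integrable.
by rewrite RintegralZl//; exact: valL_C01_integrable.
Qed.

Lemma Rintegral01_cst (c : R) : \int[mu]_(x in `[0, 1]) c = c.
Proof.
rewrite Rintegral_cst//= lebesgue_measure_itv/= lte_fin ltr01.
by rewrite -EFinB/= subr0 mulr1.
Qed.

Lemma C01_integral_le_norm f :
  `|\int[mu]_(x in `[0, 1]) ('valL_ 0 f) x| <= `|f|.
Proof.
have mI : measurable (I01 : set (measurableTypeR R)) by exact: measurable_itv.
have intf := valL_C01_integrable f.
apply: le_trans (le_normr_Rintegral mI intf) _.
(* As the interval has length 1, the norm is the integral of the constant that dominates the
   absolute value of [f]. *)
rewrite -[leRHS]Rintegral01_cst; apply: le_Rintegral => //.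
- exact: (integrable_norm intf).
- by apply: continuous_compact_integrable;
    [exact: segment_compact|exact: cst_continuous].
- move=> x /mem_set xI; rewrite -[x]/(val (SigSub xI : I01)) valL_val.
  exact: C01_le_norm.
Qed.

Lemma Haar1_C01_integral0 :
  Haar1 [set f : C01 R | \int[mu]_(x in `[0, 1]) ('valL_ 0 f) x = 0].
Proof.
have c1 : (cst 1 : I01 -> R) \in @continuous_on01 R.
  exact/asboolP/cst_continuous.
apply: (@Haar1_ker _ _ (fun f : C01 R => \int[mu]_(x in `[0, 1]) ('valL_ 0 f) x)
  (MkC01 c1)).
- exact: C01_integral_scalar.
- exact: C01_integral_le_norm.
- rewrite (@eq_Rintegral _ _ _ _ _ (cst 1)) ?Rintegral01_cst ?oner_eq0// => x xI.
  by rewrite -[x]/(val (SigSub xI : I01)) valL_val.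
Qed.

End C01_integral.

Theorem proposition1p3 (R : realType) :
  Haar1 [set f : L1 (lebesgue01 R) | \int[lebesgue01 R]_x L1_fun f x = 0] /\
  Haar1 [set f : C01 R |
    \int[lebesgue_measure]_(x in `[0, 1]) ('valL_ 0 f) x = 0].
Proof.
split; last exact: Haar1_C01_integral0.
(* The total mass is the length of the unit interval, hence neither zero nor infinite. *)
have mu1 : lebesgue01 R setT = 1%E.
  rewrite /lebesgue01 /= /mrestr setTI lebesgue_measure_itv/= lte_fin ltr01.
  by rewrite -EFinB subr0.
by apply: Haar1_L1_integral0; rewrite mu1 ?ltry// eqe oner_eq0.
Qed.
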